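(* Let $A$ be a fixed integer $2\times 2$ loss matrix with $\Delta_1>0$, $\Delta_2<0$, $\delta_1>0$, $\delta_2<0$ and $|\Delta_1|<|\Delta_2|$, and consider the Hedge-myopic system with horizon $T$. Then for all sufficiently large $T$ there is a time $T_s=T_s(T)$, with $T_s=o(T)$ as $T\to\infty$, such that the action sequence $y^M_{T_s},y^M_{T_s+1},\dots,y^M_T$ of player Y, the strategy sequence $x^M_{T_s},x^M_{T_s+1},\dots,x^M_T$ of player X and the state sequence $s^M_{T_s},s^M_{T_s+1},\dots,s^M_T$ are all periodic. Moreover, they have the same least positive period $$T^\ast=\frac{m(|\Delta_1|,|\Delta_2|)}{|\Delta_1|}+\frac{m(|\Delta_1|,|\Delta_2|)}{|\Delta_2|},$$ where $m(|\Delta_1|,|\Delta_2|)$ is the least common multiple of $|\Delta_1|$ and $|\Delta_2|$.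
   Context: Game. $A=\begin{pmatrix} a_{11} & a_{12} \\ a_{21} & a_{22} \end{pmatrix}$ has integer entries; $a_{ij}$ is the loss of player X (rows) and the payoff of player Y (columns $L,R$). Put $\delta_1=a_{11}-a_{12}$, $\delta_2=a_{21}-a_{22}$, $\Delta_1=a_{11}-a_{21}$, $\Delta_2=a_{12}-a_{22}$, $e_L=(1,0)^T$, $e_R=(0,1)^T$. The game is repeated $T$ times. Asymptotic statements are for fixed $A$ and $T\to\infty$. The learning rate $\eta=\eta_T>0$ satisfies $c/\sqrt T\le \eta_T\le C/\sqrt T$ for constants $0<c\le C$ independent of $T$ (e.g. $\eta=\sqrt{8\ln 2/T}$). Hedge. Given actions $y_1,y_2,\dots\in\{e_L,e_R\}$ of player Y, the state is $s_1=0$, $s_t=(-\Delta_1,-\Delta_2)\sum_{\tau=1}^{t-1}y_\tau$ for $t\ge 2$ (so choosing $e_L$ changes the state by $-\Delta_1$ and $e_R$ by $-\Delta_2$), and player X plays the mixed strategy $x_t=\left(\frac{1}{e^{-\eta s_t}+1},\frac{e^{-\eta s_t}}{e^{-\eta s_t}+1}\right)$ at time $t$ (this is the Hedge algorithm $x_{i,t}\propto\exp(-\eta\sum_{\tau<t}(Ay_\tau)_i)$). Hedge-myopic system. Player Y plays the myopic best response to $x_t$, i.e. maximizes $x_t^TAy$ over $y\in\{e_L,e_R\}$; explicitly, with $s^\ast=-\frac1\eta\ln(-\delta_1/\delta_2)$, the action at state $s$ is $e_R$ if $s<s^\ast$ and $e_L$ if $s\ge s^\ast$. The resulting sequences are $s^M_1=0,\dots,s^M_{T+1}$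 (states), $x^M_t$ (strategies of X), $y^M_t$ (actions of Y); thus $s^M_{t+1}=s^M_t-\Delta_2$ if $s^M_t<s^\ast$ and $s^M_{t+1}=s^M_t-\Delta_1$ if $s^M_t\ge s^\ast$. A finite sequence $a_m,\dots,a_n$ is periodic with period $p\ge1$ if $a_{t+p}=a_t$ whenever $m\le t$ and $t+p\le n$. *)

(* Defs.v *)
From HB Require Import structures.
From mathcomp Require Import all_boot all_order all_algebra.
From mathcomp Require Import all_classical all_reals all_analysis.
From mathcomp Require Import ring.

Set Implicit Arguments.
Unset Strict Implicit.
Unset Printing Implicit Defensive.

Import Order.TTheory GRing.Theory Num.Theory.
Import numFieldNormedType.Exports.

Local Open Scope ring_scope.

(* Rows 0, 1 are the actions of X; columns 0, 1 are the actions L, R of Y. *)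
Section Game.
Variable A : 'M[int]_2.

Definition delta1 : int := A 0 0 - A 0 1.
Definition delta2 : int := A 1 0 - A 1 1.
Definition Delta1 : int := A 0 0 - A 1 0.
Definition Delta2 : int := A 0 1 - A 1 1.

End Game.

Definition eL : 'cV[int]_2 := delta_mx 0 0.
Definition eR : 'cV[int]_2 := delta_mx 1 0.

(* Time starts at 1; the value at time 0 of any sequence below is junk. *)
Definition hedge_state (A : 'M[int]_2) (y : nat -> 'cV[int]_2) (t : nat) : int :=
  ((\row_(j < 2) (if j == 0 then - Delta1 A else - Delta2 A))
     *m \sum_(1 <= tau < t) y tau) 0 0.

Section HedgeMyopic.
Variables (R : realType) (A : 'M[int]_2) (eta : R).

Definition hedge_strategy (s : int) : 'cV[R]_2 :=
  \col_(i < 2) (if i == 0 then 1 / (expR (- eta * s%:~R) + 1)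
                else expR (- eta * s%:~R) / (expR (- eta * s%:~R) + 1)).

Definition payoff (x : 'cV[R]_2) (y : 'cV[int]_2) : R :=
  (x^T *m map_mx intr A *m map_mx intr y) 0 0.

Definition sstar : R := - (1 / eta) * ln (- (delta1 A)%:~R / (delta2 A)%:~R).

Definition myopic_action (s : int) : 'cV[int]_2 :=
  if s%:~R < sstar then eR else eL.

Definition myopic_step (s : int) : int :=
  if s%:~R < sstar then s - Delta2 A else s - Delta1 A.

Definition sM (t : nat) : int := iter t.-1 myopic_step 0.
Definition xM (t : nat) : 'cV[R]_2 := hedge_strategy (sM t).
Definition yM (t : nat) : 'cV[int]_2 := myopic_action (sM t).

Lemma sM_hedge_state (t : nat) : (0 < t)%N -> sM t = hedge_state A yM t.
Proof.
have E : forall z : 'cV[int]_2,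
  ((\row_(j < 2) (if j == 0 then - Delta1 A else - Delta2 A)) *m z) 0 0
  = - Delta1 A * z 0 0 - Delta2 A * z 1 0.
  by move=> z; rewrite mxE !big_ord_recl big_ord0 !mxE /= addr0 -mulNr;
     congr (_ + _ * z _ _); apply/val_inj.
case: t => // t _; rewrite /hedge_state; elim: t => [|t IH].
  by rewrite big_geq // mulmx0 mxE.
rewrite big_nat_recr //= mulmxDr mxE -IH {1}/sM /= -/(sM t.+1) E /yM.
rewrite /myopic_action /myopic_step; case: ifP => _;
  by rewrite /eR /eL !mxE /= !(mulr0, mulr1, mulNr, add0r, subr0, oppr0).
Qed.

Lemma myopic_action_best_response (s : int) :
  0 < eta -> 0 < delta1 A -> delta2 A < 0 ->
  forall y : 'cV[int]_2, y = eL \/ y = eR ->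
  payoff (hedge_strategy s) y
    <= payoff (hedge_strategy s) (myopic_action s).
Proof.
move=> eta0 d1 d2.
set E := expR (- eta * s%:~R); have E0 : 0 < E by exact: expR_gt0.
have E1 : 0 < E + 1 by rewrite addr_gt0.
have payE y : payoff (hedge_strategy s) y =
   (((A 0 0)%:~R + E * (A 1 0)%:~R) * (y 0 0)%:~R
    + ((A 0 1)%:~R + E * (A 1 1)%:~R) * (y 1 0)%:~R) / (E + 1).
  rewrite /payoff /hedge_strategy !mxE !big_ord_recl big_ord0 !mxE.
  rewrite !big_ord_recl !big_ord0 !mxE /= -/E.
  have -> : lift ord0 ord0 = 1 :> 'I_2 by apply/val_inj.
  by field; rewrite gt_eqF.
have diffE : payoff (hedge_strategy s) eL - payoff (hedge_strategy s) eR =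
   ((delta1 A)%:~R + E * (delta2 A)%:~R) / (E + 1).
  rewrite !payE /eL /eR !mxE /= /delta1 /delta2 !rmorphB /=.
  by field; rewrite gt_eqF.
have d1R : 0 < (delta1 A)%:~R :> R by rewrite ltr0z.
have d2R : 0 < - (delta2 A)%:~R :> R by rewrite oppr_gt0 ltrz0.
have qE : - (delta1 A)%:~R / (delta2 A)%:~R
          = (delta1 A)%:~R / - (delta2 A)%:~R :> R.
  by rewrite invrN mulrN mulNr.
have q0 : 0 < (delta1 A)%:~R / - (delta2 A)%:~R :> R by rewrite divr_gt0.
have sE : (s%:~R < sstar) = ((delta1 A)%:~R + E * (delta2 A)%:~R < 0).
  have -> : ((delta1 A)%:~R + E * (delta2 A)%:~R < 0)
            = ((delta1 A)%:~R / - (delta2 A)%:~R < E).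
    by rewrite ltr_pdivrMr // mulrN -[in RHS]subr_lt0 opprK.
  rewrite /sstar qE; move: (_ / - _) q0 => q q0.
  rewrite -[in RHS](lnK q0) ltr_expR div1r !mulNr.
  by rewrite ltrNr ltr_pdivrMl // mulrN.
rewrite /myopic_action sE => y [] ->; case: ltP => h; rewrite // -subr_ge0.
- by rewrite -opprB diffE -mulNr divr_ge0 ?ltW // oppr_gt0.
- by rewrite diffE divr_ge0 // ltW.
Qed.

End HedgeMyopic.

Definition periodic (X : Type) (a : nat -> X) (m n p : nat) : Prop :=
  (1 <= p)%N /\
  forall t, (m <= t)%N -> (t + p <= n)%N -> a (t + p)%N = a t.

Definition least_period (X : Type) (a : nat -> X) (m n p : nat) : Prop :=
  periodic a m n p /\ forall q, periodic a m n q -> (p <= q)%N.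

(* Both quotients are exact. *)
Definition Tstar (A : 'M[int]_2) : nat :=
  let d1 := `|Delta1 A|%N in
  let d2 := `|Delta2 A|%N in
  (lcmn d1 d2 %/ d1 + lcmn d1 d2 %/ d2)%N.

(* Main.v *)
(** Let [n] be the ceiling of s*.  The state moves by [+b] below [n] and by [-a]
    otherwise, with [a = |Delta1|] and [b = |Delta2|].  It enters the window
    [n - a, n + b) after at most [|n| = O(1/eta) = O(sqrt T)] steps and stays
    there; on that window, of length [a + b], the move is the rotation by [b]
    modulo [a + b], of order [(a + b) / gcd(a, b)].  Strategies determine states
    because exp is injective.  Actions determine increments only, but a shift by a
    period [q] of the actions changes the state by a constant amount, which must
    vanish because the states stay bounded. *)
Require Import Defs.
From HB Require Import structures.
From mathcomp Require Import all_boot all_order all_algebra.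
From mathcomp Require Import all_classical all_reals all_analysis.
From mathcomp Require Import zify lra.

Set Implicit Arguments.
Unset Strict Implicit.
Unset Printing Implicit Defensive.

Import Order.TTheory GRing.Theory Num.Theory.
Import numFieldNormedType.Exports.

Local Open Scope classical_set_scope.
Local Open Scope ring_scope.

Section ThresholdStep.
Variables (n : int) (a b : nat).
Hypotheses (a_gt0 : (0 < a)%N) (b_gt0 : (0 < b)%N).

Definition threshold_step (s : int) : int :=
  if s < n then s + b%:Z else s - a%:Z.

Definition in_window (s : int) : bool := (n - a%:Z <= s) && (s < n + b%:Z).

Lemma in_window_step s : in_window s -> in_window (threshold_step s).
Proof. by rewrite /in_window /threshold_step; case: ifP; lia. Qed.

Lemma in_window_iter k s : in_window s -> in_window (iter k threshold_step s).
Proof. by move=> ws; elim: k => //= k; apply: in_window_step. Qed.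

(** A step that still lands outside the window has not crossed [n], hence has brought the state
    closer to [n] by at least 1. *)
Lemma iter_in_window k s :
  (`|n - s| <= k)%N -> in_window (iter k threshold_step s).
Proof.
elim: k s => [|k IH] s le_k; first by rewrite /in_window /=; lia.
rewrite iterSr; have [ws|nws] := boolP (in_window (threshold_step s)).
  exact: in_window_iter.
apply: IH; move: nws le_k.
by rewrite /in_window /threshold_step; case: ifP; lia.
Qed.

(** Since [- a = b - (a + b)], every step is [+ b] modulo [a + b]; [i] counts the downward steps. *)
Lemma iter_threshold_step k s : exists i : nat,
  iter k threshold_step s = s + k%:Z * b%:Z - i%:Z * (a + b)%:Z.
Proof.
elim: k => [|k [i IH]]; first by exists 0%N; rewrite !mul0r addr0 subr0.
rewrite iterS {1}/threshold_step IH; case: ifP => _.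
- by exists i; lia.
- by exists i.+1; lia.
Qed.

Let g := gcdn a b.

(** The order of [b] modulo [a + b], written as a sum to match the two quotients in [Tstar]. *)
Definition rotation_order : nat := (a %/ g + b %/ g)%N.

Lemma lcmn_divn_add : (lcmn a b %/ a + lcmn a b %/ b)%N = rotation_order.
Proof.
have lcmE : lcmn a b = (a * (b %/ g))%N by rewrite muln_divA // dvdn_gcdr.
rewrite {1}lcmE mulKn // lcmE muln_divCA_gcd mulKn //.
exact: addnC.
Qed.

(** The total displacement is a multiple of [a + b], while two points of the window differ by less
    than [a + b]. *)
Lemma iter_rotation_order s :
  in_window s -> iter rotation_order threshold_step s = s.
Proof.
move=> ws; have := in_window_iter rotation_order ws; move: ws.
have [i ->] := iter_threshold_step rotation_order s.
have -> : rotation_order%:Z * b%:Z = (b %/ g)%:Z * (a + b)%:Z.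
  rewrite -!PoszM; congr Posz; rewrite /rotation_order mulnDl mulnDr.
  by congr (_ + _)%N; rewrite [LHS]mulnC [RHS]mulnC muln_divCA_gcd.
rewrite /in_window -addrA -mulrBl; move: ((b %/ g)%:Z - i%:Z) => x.
have [->|x_neq0] := eqVneq x 0; first by rewrite mul0r addr0.
by nia.
Qed.

(** A return gives [k * b = i * (a + b)]. After division by [g], [rotation_order] divides
    [k * (b %/ g)] and is coprime to [b %/ g]. *)
Lemma iter_threshold_step_fixed k s :
  iter k threshold_step s = s -> (rotation_order %| k)%N.
Proof.
have [i ->] := iter_threshold_step k s => ks.
have {ks} : (k * b = i * (a + b))%N by lia.
have g_gt0 : (0 < g)%N by rewrite gcdn_gt0 a_gt0.
have bE : b = (b %/ g * g)%N by rewrite divnK // dvdn_gcdr.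
have aE : a = (a %/ g * g)%N by rewrite divnK // dvdn_gcdl.
rewrite {1}bE [in (a + b)%N]aE [in X in (_ + X)%N]bE -mulnDl !mulnA => /eqP.
rewrite eqn_pmul2r // => /eqP kE.
have cop : coprime rotation_order (b %/ g).
  rewrite /rotation_order /coprime gcdnC gcdnDr gcdnC.
  by rewrite -(eqn_pmul2r g_gt0) muln_gcdl -aE -bE mul1n.
by rewrite -(Gauss_dvdl k cop) kE dvdn_mull.
Qed.

Lemma rotation_order_gt0 : (0 < rotation_order)%N.
Proof. by rewrite addn_gt0 divn_gt0 ?gcdn_gt0 ?a_gt0 // dvdn_leq ?dvdn_gcdl. Qed.

Section Orbit.
Variable s0 : int.

(* The [.-1] makes the orbit start at time 1, as for [sM]. *)
Definition threshold_orbit (t : nat) : int := iter t.-1 threshold_step s0.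

Lemma threshold_orbitD t k : (0 < t)%N ->
  threshold_orbit (t + k) = iter k threshold_step (threshold_orbit t).
Proof. by case: t => // t _; rewrite /threshold_orbit addSn /= addnC iterD. Qed.

(** [f] is what is observed of the state. Assuming only that it reveals the side of [n] treats
    actions, strategies and states at once. *)
Variables (X : Type) (f : int -> X) (m T : nat).
Hypotheses (m_gt0 : (0 < m)%N) (window_m : in_window (threshold_orbit m)).
Hypothesis f_threshold : forall s s', f s = f s' -> (s < n) = (s' < n).

Lemma in_window_orbit t : (m <= t)%N -> in_window (threshold_orbit t).
Proof. by move=> /subnKC <-; rewrite threshold_orbitD //; apply: in_window_iter. Qed.

(** Equal observations force equal increments, so the orbit and its shift by [q] move in
    parallel. *)
Lemma shift_orbit_const q t : Defs.periodic (f \o threshold_orbit) m T q ->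
  (m + t + q <= T)%N ->
  threshold_orbit (m + t + q) - threshold_orbit (m + t)
    = threshold_orbit (m + q) - threshold_orbit m.
Proof.
move=> [_ per]; elim: t => [|t IH] le_T; first by rewrite addn0.
rewrite -IH; last by lia.
have mt_gt0 : (0 < m + t)%N by rewrite addn_gt0 m_gt0.
have mtq_gt0 : (0 < m + t + q)%N by rewrite addn_gt0 mt_gt0.
have -> : (m + t.+1 + q = (m + t + q) + 1)%N by lia.
have -> : (m + t.+1 = (m + t) + 1)%N by lia.
rewrite !(@threshold_orbitD _ 1) //= /threshold_step.
have /f_threshold-> : f (threshold_orbit (m + t + q)) = f (threshold_orbit (m + t)).
  by apply: per; lia.
by case: ifP => _; lia.
Qed.

(** The drift [D] adds up over successive periods: after [a + b] of them a nonzero [D] would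
    displace the orbit by at least [a + b], out of the window. Hence the room demanded before
    [T]. *)
Lemma period_observed_orbit q :
  (m + (a + b) * q <= T)%N -> Defs.periodic (f \o threshold_orbit) m T q ->
  threshold_orbit (m + q) = threshold_orbit m.
Proof.
move=> le_T per; set D := threshold_orbit (m + q) - threshold_orbit m.
have orbE k : (m + k * q <= T)%N ->
    threshold_orbit (m + k * q) = threshold_orbit m + k%:Z * D.
  elim: k => [|k IH] le_kT; first by rewrite mul0n addn0 mul0r addr0.
  have := @shift_orbit_const q (k * q)%N per.
  rewrite -addnA -mulSnr => /(_ le_kT) /eqP; rewrite subr_eq => /eqP ->.
  rewrite IH -/D; last by move: le_kT; rewrite mulSn; lia.
  by lia.
have := in_window_orbit (leq_addr ((a + b) * q)%N m).
move: window_m; rewrite orbE // /in_window.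
have [/eqP|D_neq0] := eqVneq D 0; first by rewrite subr_eq0 => /eqP.
by nia.
Qed.

Lemma least_period_orbit : (m + (a + b) * rotation_order <= T)%N ->
  least_period (f \o threshold_orbit) m T rotation_order.
Proof.
move=> le_T; split.
  split; first exact: rotation_order_gt0.
  move=> t le_mt _ /=; rewrite threshold_orbitD ?(leq_trans m_gt0) //.
  by rewrite iter_rotation_order // in_window_orbit.
(* Only [q < rotation_order] has to be excluded, and for such [q] the horizon leaves room for
   [a + b] periods. *)
move=> q per; have [q_gt0 _] := per; rewrite leqNgt; apply/negP => lt_q.
have le_qT : (m + (a + b) * q <= T)%N.
  by rewrite (leq_trans _ le_T) // leq_add2l leq_mul2l (ltnW lt_q) orbT.
have := period_observed_orbit le_qT per.
rewrite threshold_orbitD // => /iter_threshold_step_fixed /dvdn_leq.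
by move=> /(_ q_gt0); rewrite leqNgt lt_q.
Qed.

End Orbit.

End ThresholdStep.

(** With [r = Num.sqrt T%:R >= 1], the left side is at most [(]|K| + 2) *
    r[, and]r[eventually exceeds]([|K| + 2) / eps]. *)
Lemma near_infty_sqrt_le (R : realType) (K eps : R) : 0 < eps ->
  \forall T \near \oo, K * Num.sqrt T%:R + 2 <= eps * T%:R.
Proof.
move=> eps_gt0; near=> T.
have T_ge1 : 1 <= T%:R :> R by rewrite ler1n; near: T; exact: nbhs_infty_ge.
have T_large : ((`|K| + 2) / eps) ^+ 2 <= T%:R by near: T; exact: nbhs_infty_ger.
set r := Num.sqrt T%:R.
have r2 : r ^+ 2 = T%:R by rewrite sqr_sqrtr.
have r_ge1 : 1 <= r by rewrite -sqrtr1 ler_sqrt.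
have r_ge : `|K| + 2 <= eps * r.
  rewrite mulrC -ler_pdivrMr // -(@ler_pXn2r _ 2) ?nnegrE //.
  - by rewrite r2.
  - by rewrite divr_ge0 ?addr_ge0 // ltW.
  - exact: sqrtr_ge0.
rewrite -r2; have := ler_norm K; nra.
Unshelve. all: by end_near.
Qed.

Section Myopic.
Variables (R : realType) (A : 'M[int]_2) (eta : R).

Lemma ltr_sstar (s : int) : (s%:~R < sstar A eta) = (s < Num.ceil (sstar A eta)).
Proof. by rewrite ceil_gt_int. Qed.

Lemma myopic_stepE : 0 < Delta1 A -> Delta2 A < 0 ->
  myopic_step A eta =1
    threshold_step (Num.ceil (sstar A eta)) `|Delta1 A|%N `|Delta2 A|%N.
Proof.
move=> D1 D2 s; rewrite /myopic_step /threshold_step ltr_sstar.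
by case: ifP => _; lia.
Qed.

Lemma hedge_strategy_inj : 0 < eta -> injective (@hedge_strategy R eta).
Proof.
move=> eta_gt0 s s' /matrixP /(_ 0 0); rewrite !mxE /= !div1r.
by move=> /invr_inj /addIr /expR_inj /mulfI; rewrite oppr_eq0 gt_eqF // =>
  /(_ isT) /intr_inj.
Qed.

Lemma myopic_action_threshold s s' :
  myopic_action A eta s = myopic_action A eta s' ->
  (s < Num.ceil (sstar A eta)) = (s' < Num.ceil (sstar A eta)).
Proof.
have neq : eL <> eR by move=> /matrixP /(_ 0 0); rewrite !mxE.
rewrite /myopic_action !ltr_sstar.
by case: ifP => _; case: ifP => _ // E; case: neq.
Qed.

End Myopic.

Theorem theorem4p1 (R : realType) (A : 'M[int]_2) (eta : nat -> R) (c C : R)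
    (c_gt0 : 0 < c) (le_cC : c <= C)
    (eta_gt0 : forall T : nat, (0 < T)%N -> 0 < eta T)
    (eta_bounds : forall T : nat, (0 < T)%N ->
       c / Num.sqrt T%:R <= eta T <= C / Num.sqrt T%:R)
    (Delta1_gt0 : 0 < Delta1 A) (Delta2_lt0 : Delta2 A < 0)
    (delta1_gt0 : 0 < delta1 A) (delta2_lt0 : delta2 A < 0)
    (Delta_lt : `|Delta1 A| < `|Delta2 A|) :
  exists Ts : nat -> nat,
    (fun T : nat => (Ts T)%:R : R^o) =o_\oo (fun T : nat => T%:R : R^o) /\
    \forall T \near \oo,
      [/\ (1 <= Ts T <= T)%N,
          least_period (yM A (eta T)) (Ts T) T (Tstar A),
          least_period (xM A (eta T)) (Ts T) T (Tstar A)
        & least_period (sM A (eta T)) (Ts T) T (Tstar A)].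
Proof.
pose n T : int := Num.ceil (sstar A (eta T)).
(* From state 0 the window is reached within [|n T|] steps; the successor is there because time
   starts at 1. *)
pose Ts T := `|n T|%N.+1.
pose a := `|Delta1 A|%N; pose b := `|Delta2 A|%N.
have a_gt0 : (0 < a)%N by rewrite /a; lia.
have b_gt0 : (0 < b)%N by rewrite /b; lia.
(* The lower bound on [eta T] gives [1 / eta T <= Num.sqrt T%:R / c], which bounds s*. The 2 in
   [Ts_le] pays for the ceiling in [n T] and the successor in [Ts]. *)
pose K : R := `|ln (- (delta1 A)%:~R / (delta2 A)%:~R)| / c.
have Ts_le T : (0 < T)%N -> (Ts T)%:R <= K * Num.sqrt T%:R + 2.
  move=> T_gt0; have r_gt0 : 0 < Num.sqrt T%:R :> R by rewrite sqrtr_gt0 ltr0n.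
  have et_gt0 := eta_gt0 _ T_gt0; have /andP[le_eta _] := eta_bounds _ T_gt0.
  have le_s : `|sstar A (eta T)| <= K * Num.sqrt T%:R.
    rewrite /sstar /K div1r mulNr normrN normrM gtr0_norm ?invr_gt0 //.
    rewrite mulrC -mulrA ler_wpM2l // -[Num.sqrt _]invrK -invfM.
    by rewrite lef_pV2 // posrE ?mulr_gt0 ?invr_gt0.
  have : `|n T|%:~R <= `|sstar A (eta T)| + 1 :> R.
    rewrite intr_norm ler_norml.
    have := ceilB1_lt (sstar A (eta T)); have := ceil_ge (sstar A (eta T)).
    have := ler_norm (sstar A (eta T)).
    have := ler_norm (- sstar A (eta T)); rewrite normrN intrB -/(n T).
    by move=> *; apply/andP; split; lra.
  rewrite /Ts -natr1 natr_absz; lra.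
have Ts_small eps : 0 < eps -> \forall T \near \oo, (Ts T)%:R <= eps * T%:R :> R.
  move=> eps_gt0; near=> T; apply: (le_trans (Ts_le _ _)).
    by near: T; exact: nbhs_infty_gt.
  by near: T; exact: near_infty_sqrt_le.
exists Ts; split.
  apply/eqoP => eps eps_gt0; near=> T.
  by rewrite !normr_nat; near: T; exact: Ts_small.
near=> T.
have T_gt0 : (0 < T)%N by near: T; exact: nbhs_infty_gt.
have T_large : (Ts T + (a + b) * rotation_order a b <= T)%N.
  (* Half of [T] covers the transient, the other half the remaining term, which does not depend on
     [T]. *)
  have : (Ts T)%:R <= 2^-1 * T%:R :> R by near: T; apply: Ts_small.
  rewrite mulrC ler_pdivlMr // -natrM ler_nat.
  have : (2 * ((a + b) * rotation_order a b) <= T)%N.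
    by near: T; exact: nbhs_infty_ge.
  by lia.
have sE : sM A (eta T) = threshold_orbit (n T) a b 0.
  by apply/funext => t; apply: eq_iter; apply: myopic_stepE.
have window : in_window (n T) a b (threshold_orbit (n T) a b 0 (Ts T)).
  by apply: iter_in_window; rewrite ?subr0.
have lp X (f : int -> X) : (forall s s', f s = f s' -> (s < n T) = (s' < n T)) ->
    least_period (f \o sM A (eta T)) (Ts T) T (Tstar A).
  move=> f_thr; rewrite sE /Tstar lcmn_divn_add //.
  exact: least_period_orbit.
split.
- by rewrite /= (leq_trans _ T_large) // leq_addr.
- exact/lp/myopic_action_threshold.
- by apply: lp => s s' /(hedge_strategy_inj (eta_gt0 _ T_gt0)) ->.
- by apply: (lp int id) => s s' ->.
Unshelve. all: by end_near.
Qed.
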